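(* Let $R$ be a Noetherian integral domain that is not a field. Then the following statements are equivalent: (1) $R$ is a Dedekind domain. (2) For every nonzero proper ideal $I$ of $R$: $I$ is a 1-absorbing primary ideal of $R$ if and only if $I=P^{n}$ for some prime ideal $P$ of $R$ and some positive integer $n$.
   Context: For an ideal $I$ of a commutative ring $R$, $\sqrt{I}=\{r\in R \mid r^{n}\in I \text{ for some integer } n\geq 1\}$. A proper ideal $I$ of $R$ is called a 1-absorbing primary ideal of $R$ if whenever $a,b,c\in R$ are nonunit elements with $abc\in I$, then $ab\in I$ or $c\in\sqrt{I}$. An integral domain $R$ with quotient field $K$ is called a Dedekind domain if every nonzero proper ideal $I$ of $R$ is invertible, i.e. $II^{-1}=R$ where $I^{-1}=\{r\in K\mid rI\subseteq R\}$. *)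

(* Defs.v *)
From mathcomp Require Import all_boot all_order all_algebra.
From mathcomp Require Import boolp classical_sets.

Set Implicit Arguments.
Unset Strict Implicit.
Unset Printing Implicit Defensive.

Import GRing.Theory.
Local Open Scope classical_set_scope.
Local Open Scope ring_scope.

(* Subsets are Prop-valued ([set R]), so that no decidability is imposed on
   ideals; [[in I]] is the boolean predicate that the library notions expect. *)

(* An ideal, not necessarily proper, is a submodule of the regular module. *)
Definition is_ideal (R : comNzRingType) (I : set R) : Prop :=
  submod_closed ([in I] : {pred R^o}).

(* [idealr_closed] already contains properness, as [1 \notin I]. *)
Definition is_proper_ideal (R : comNzRingType) (I : set R) : Prop :=
  idealr_closed [in I].

Definition is_prime_ideal (R : comNzRingType) (P : set R) : Prop :=
  is_proper_ideal P /\ prime_idealr_closed [in P].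

Lemma is_idealP (R : comNzRingType) (I : set R) :
  is_ideal I <->
  [/\ I 0, forall x y, I x -> I y -> I (x + y) & forall a x, I x -> I (a * x)].
Proof.
split=> [[/set_mem I0 IZD]|[I0 ID IM]].
  split=> // [x y /mem_set xI /mem_set yI|a x /mem_set xI].
    by have /set_mem := IZD 1 _ _ xI yI; rewrite scale1r.
  by have /set_mem := IZD a _ _ xI (mem_set I0); rewrite addr0.
split=> [|a u v /set_mem uI /set_mem vI]; first exact: mem_set.
by apply: mem_set; apply: ID => //; apply: IM.
Qed.

Lemma is_proper_idealP (R : comNzRingType) (I : set R) :
  is_proper_ideal I <-> is_ideal I /\ I != [set: R].
Proof.
split=> [[I0 I1 IZD]|[/is_idealP[I0 ID IM] IT]].
  by split=> //; apply/eqP => IE; rewrite IE in_setT in I1.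
split=> [||a u v /set_mem uI /set_mem vI]; first exact: mem_set.
  apply: contra IT => /set_mem I1; apply/eqP/seteqP; split=> // x _.
  by rewrite -[x]mulr1; apply: IM.
by apply: mem_set; apply: ID => //; apply: IM.
Qed.

Definition noetherian (R : comNzRingType) : Prop :=
  forall I : set R, is_ideal I -> exists s : seq R, I = smallest (@is_ideal R) [set` s].

(* Finite sums of products of an element of [A] by an element of [B]. *)
Definition setprod (S : comNzRingType) (A B : set S) : set S :=
  [set x | exists2 s : seq (S * S),
     forall p, p \in s -> A p.1 /\ B p.2 & x = \sum_(p <- s) p.1 * p.2].

(* By convention, the zeroth power is the whole ring. *)
Definition ideal_pow (R : comNzRingType) (P : set R) (n : nat) : set R :=
  iter n (setprod P) [set: R].

Definition radical (R : comNzRingType) (I : set R) : set R :=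
  [set r | exists2 n : nat, (1 <= n)%N & I (r ^+ n)].

Definition one_absorbing_primary (R : idomainType) (I : set R) : Prop :=
  is_proper_ideal I /\
  forall a b c : R,
    a \isn't a GRing.unit -> b \isn't a GRing.unit -> c \isn't a GRing.unit ->
    I (a * b * c) -> I (a * b) \/ radical I c.

Definition ideal_inv (R : idomainType) (I : set R) : set {fraction R} :=
  [set r | [set r * tofrac x | x in I] `<=` range (@tofrac R)].

Definition invertible (R : idomainType) (I : set R) : Prop :=
  setprod (@tofrac R @` I) (ideal_inv I) = range (@tofrac R).

Definition dedekind (R : idomainType) : Prop :=
  forall I : set R, is_proper_ideal I -> I <> [set 0] -> invertible I.

(* Main.v *)
(* (1 => 2): every nonzero prime ideal is maximal, and the radical of a
   1-absorbing primary ideal is prime. If I has maximal radical P, then I is R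
   or I = P (I : P), where (I : P) strictly contains I; Noetherian induction
   makes I a power of P.
   (2 => 1): for M maximal and x in M \ M^2, the ideal M^2 + (x) has radical M,
   hence is 1-absorbing primary, hence a power of M, hence M. By Nakayama some
   a = 1 + m sends M into (x), so a / x lies in M^-1 and
   1 = x (a / x) - m lies in M M^-1. Invertibility of all nonzero ideals follows
   by Noetherian induction from I = M (I : M). *)
Require Import Defs.
From mathcomp Require Import all_boot all_order all_algebra.
From mathcomp Require Import boolp classical_sets.
From mathcomp Require Import ring.

Local Open Scope classical_set_scope.
Local Open Scope ring_scope.

Import GRing.Theory.

Set Implicit Arguments.
Unset Strict Implicit.
Unset Printing Implicit Defensive.

(** * Ideals, colon ideals and adjunction of an element *)

Lemma ideal0 (R : comNzRingType) (I : set R) : is_ideal I -> I 0.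
Proof. by case/is_idealP. Qed.

Lemma idealD (R : comNzRingType) (I : set R) (x y : R) :
  is_ideal I -> I x -> I y -> I (x + y).
Proof. by case/is_idealP=> _ ID _; apply: ID. Qed.

Lemma idealM (R : comNzRingType) (I : set R) (a x : R) :
  is_ideal I -> I x -> I (a * x).
Proof. by case/is_idealP=> _ _; apply. Qed.

Lemma idealMr (R : comNzRingType) (I : set R) (a x : R) :
  is_ideal I -> I x -> I (x * a).
Proof. by rewrite mulrC; apply: idealM. Qed.

Lemma idealB (R : comNzRingType) (I : set R) (x y : R) :
  is_ideal I -> I x -> I y -> I (x - y).
Proof. by move=> idI Ix Iy; apply: idealD => //; rewrite -mulN1r; apply: idealM. Qed.

Lemma ideal1 (R : comNzRingType) (I : set R) (x : R) : is_ideal I -> I 1 -> I x.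
Proof. by move=> idI I1; rewrite -[x]mulr1; apply: idealM. Qed.

Lemma ideal_set1 (R : comNzRingType) : is_ideal [set (0 : R)].
Proof.
by apply/is_idealP; split=> // [x y /= -> ->|a x /= ->]; rewrite ?addr0 ?mulr0.
Qed.

Lemma proper_idealE (R : comNzRingType) (I : set R) :
  is_proper_ideal I <-> is_ideal I /\ ~ I 1.
Proof.
rewrite is_proper_idealP; split=> -[idI IT]; split=> //.
  move=> I1; move/eqP: IT; apply; apply/seteqP; split=> // x _; exact: ideal1.
by apply/eqP => IE; apply: IT; rewrite IE.
Qed.

Lemma ideal_neq0P (R : comNzRingType) (I : set R) :
  is_ideal I -> (I <> [set 0] <-> exists2 x, I x & x != 0).
Proof.
move=> idI; split=> [In0|[x Ix xn0] IE]; last by rewrite IE /= in Ix; case/eqP: xn0.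
apply: contrapT => noI; apply: In0; apply/seteqP; split=> [x Ix|x ->] /=; last exact: ideal0.
by apply: contrapT => /eqP xn0; apply: noI; exists x.
Qed.

Definition principal (R : comNzRingType) (d : R) : set R := range ( *%R d).

Lemma principal_ideal (R : comNzRingType) (d : R) : is_ideal (principal d).
Proof.
apply/is_idealP; split=> [|_ _ [r _ <-] [t _ <-]|a _ [r _ <-]].
- by exists 0; rewrite ?mulr0.
- by exists (r + t); rewrite ?mulrDr.
- by exists (a * r); rewrite // mulrCA.
Qed.

(** Since [A] may be any set, [colon I [set y]] turns a condition on multiples of a single [y] into
    an ideal, to which lemmas about ideals apply. *)
Definition colon (R : comNzRingType) (I A : set R) : set R :=
  [set r | forall x, A x -> I (r * x)].

Lemma colon_ideal (R : comNzRingType) (I A : set R) :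
  is_ideal I -> is_ideal (colon I A).
Proof.
move=> idI; apply/is_idealP; split=> [x Ax|r t Ir It x Ax|a r Ir x Ax].
- by rewrite mul0r; apply: ideal0.
- by rewrite mulrDl; apply: idealD => //; [apply: Ir|apply: It].
- by rewrite -mulrA; apply: idealM => //; apply: Ir.
Qed.

Lemma sub_colon (R : comNzRingType) (I A : set R) :
  is_ideal I -> I `<=` colon I A.
Proof. by move=> idI x Ix y _; apply: idealMr. Qed.

Definition adjoin (R : comNzRingType) (g : R) (I : set R) : set R :=
  [set r * g + y | r in [set: R] & y in I].

Lemma adjoinP (R : comNzRingType) (g : R) (I : set R) (x : R) :
  adjoin g I x <-> exists r y, I y /\ x = r * g + y.
Proof.
by split=> [[r _ [y Iy <-]]|[r [y [Iy ->]]]]; [exists r, y|exists r => //; exists y].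
Qed.

Lemma adjoin_ideal (R : comNzRingType) (g : R) (I : set R) :
  is_ideal I -> is_ideal (adjoin g I).
Proof.
move=> idI; apply/is_idealP; split.
- by apply/adjoinP; exists 0, 0; split; [apply: ideal0|ring].
- move=> _ _ /adjoinP[r [y [Iy ->]]] /adjoinP[t [z [Iz ->]]]; apply/adjoinP.
  by exists (r + t), (y + z); split; [apply: idealD|ring].
- move=> a _ /adjoinP[r [y [Iy ->]]]; apply/adjoinP.
  by exists (a * r), (a * y); split; [apply: idealM|ring].
Qed.

Lemma sub_adjoin (R : comNzRingType) (g : R) (I : set R) : I `<=` adjoin g I.
Proof. by move=> y Iy; apply/adjoinP; exists 0, y; split=> //; ring. Qed.

Lemma mem_adjoin (R : comNzRingType) (g : R) (I : set R) :
  is_ideal I -> adjoin g I g.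
Proof. by move=> /ideal0 I0; apply/adjoinP; exists 1, 0; split=> //; ring. Qed.

(** * Products and powers of ideals *)

Lemma setprod0 (S : comNzRingType) (A B : set S) : setprod A B 0.
Proof. by exists [::] => //; rewrite big_nil. Qed.

Lemma setprodM (S : comNzRingType) (A B : set S) (a b : S) :
  A a -> B b -> setprod A B (a * b).
Proof.
move=> Aa Bb; exists [:: (a, b)]; last by rewrite big_seq1.
by move=> p; rewrite inE => /eqP ->.
Qed.

Lemma setprodD (S : comNzRingType) (A B : set S) (x y : S) :
  setprod A B x -> setprod A B y -> setprod A B (x + y).
Proof.
move=> [s sAB ->] [t tAB ->]; exists (s ++ t); last by rewrite big_cat.
by move=> p; rewrite mem_cat => /orP[/sAB|/tAB].
Qed.

(** [K] is only asked to be additive, so that the induction also covers products taken in the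
    fraction field. *)
Lemma setprod_ind (S : comNzRingType) (A B K : set S) :
  K 0 -> (forall x y, K x -> K y -> K (x + y)) ->
  (forall a b, A a -> B b -> K (a * b)) -> setprod A B `<=` K.
Proof.
move=> K0 KD KM _ [s sAB ->]; rewrite big_seq; apply: big_ind => // p /sAB[Ap Bp].
exact: KM.
Qed.

Lemma setprod_sub (R : comNzRingType) (A B K : set R) :
  is_ideal K -> (forall a b, A a -> B b -> K (a * b)) -> setprod A B `<=` K.
Proof.
by move=> idK; apply: setprod_ind; [apply: ideal0|move=> *; apply: idealD].
Qed.

Lemma setprod_ideal (R : comNzRingType) (A B : set R) :
  is_ideal B -> is_ideal (setprod A B).
Proof.
move=> idB; apply/is_idealP; split; [exact: setprod0|exact: setprodD|].
move=> r; apply: setprod_ind => [|x y ABx ABy|a b Aa Bb] /=.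
- by rewrite mulr0; apply: setprod0.
- by rewrite mulrDr; apply: setprodD.
- by rewrite mulrCA; apply: setprodM => //; apply: idealM.
Qed.

Lemma setprodS (R : comNzRingType) (A B C : set R) :
  B `<=` C -> setprod A B `<=` setprod A C.
Proof. by move=> BC _ [s sAB ->]; exists s => // p /sAB[? /BC]. Qed.

Lemma ideal_powS (R : comNzRingType) (P : set R) (n : nat) :
  ideal_pow P n.+1 = setprod P (ideal_pow P n).
Proof. by []. Qed.

Lemma ideal_pow_sub (R : comNzRingType) (P : set R) (n : nat) :
  is_ideal P -> (0 < n)%N -> ideal_pow P n `<=` P.
Proof. by case: n => // n idP _; apply: setprod_sub => // a b Pa _; apply: idealMr. Qed.

Lemma mem_ideal_pow (R : comNzRingType) (P : set R) (x : R) (n : nat) :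
  P x -> ideal_pow P n (x ^+ n).
Proof. by move=> Px; elim: n => // n IH; rewrite exprS; apply: setprodM. Qed.

Lemma ideal_pow1 (R : comNzRingType) (P : set R) : is_ideal P -> ideal_pow P 1 = P.
Proof.
move=> idP; apply/seteqP; split; first exact: ideal_pow_sub.
by move=> x Px; rewrite -[x]mulr1; apply: setprodM.
Qed.

(** * Maximal elements in Noetherian rings and maximal ideals *)

(* Ascending chains of ideals have a top element, so Zorn's lemma applies. The
   empty set joins the family because it is the union of the empty chain. *)
Lemma noetherian_max (R : comNzRingType) (Q : set (set R)) (I0 : set R) :
  noetherian R -> (forall I, Q I -> is_ideal I) -> Q I0 ->
  exists I, Q I /\ forall J, Q J -> I `<=` J -> J `<=` I.
Proof.
move=> noethR Qid QI0; pose P := [set I | I = set0 \/ Q I].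
have [F FP totF|I [PI Imax]] := @Zorn_bigcup _ P; last first.
  exists I; split=> [|J QJ IJ].
    case: PI => // I_0; case: (Imax I0); last by right.
    rewrite I_0 properEneq; split=> //; apply/eqP => I0E.
    by have := ideal0 (Qid _ QI0); rewrite -I0E.
  by apply: contrapT => JI; case: (Imax J); [split|right].
have [[K [FK Kn0]]|noF] := pselect (exists K, F K /\ K <> set0); last first.
  left; rewrite -subset0 => x [K FK Kx]; apply: noF; exists K; split=> // KE.
  by rewrite KE in Kx.
pose U := \bigcup_(X in F) X.
have Fid X x : F X -> X x -> is_ideal X.
  by move=> /FP[->|/Qid].
have idK : is_ideal K by have /FP[//|/Qid] := FK.
have idU : is_ideal U.
  apply/is_idealP; split.
  - by exists K => //; apply: ideal0.
  - move=> x y [X FX Xx] [Y FY Yy].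
    have [idX idY] := (Fid _ _ FX Xx, Fid _ _ FY Yy).
    have [XY|YX] := totF X Y FX FY.
      by exists Y => //; apply: idealD => //; apply: XY.
    by exists X => //; apply: idealD => //; apply: YX.
  - by move=> a x [X FX Xx]; exists X => //; apply: idealM => //; apply: (Fid _ x).
have [s Us] := noethR _ idU.
(* The chain is total, so the finitely many generators of [U] already lie in one nonempty member;
   [K] serves the empty list. *)
have [X [FX Xn0 sX]] : exists X, [/\ F X, X <> set0 & {subset s <= [in X]}].
  have sU : forall x, x \in s -> U x by move=> x xs; rewrite Us; apply: sub_gen_smallest.
  elim: s sU {Us} => [|g s IH] sU; first by exists K.
  have [|X [FX Xn0 sX]] := IH; first by move=> x xs; apply: sU; rewrite inE xs orbT.
  have [|Y FY Yg] := sU g; first by rewrite inE eqxx.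
  have Yn0 : Y <> set0 by move=> YE; rewrite YE in Yg.
  have [XY|YX] := totF X Y FX FY.
    exists Y; split=> // x; rewrite inE => /orP[/eqP ->|/sX /set_mem Xx]; apply: mem_set => //.
    exact: XY.
  exists X; split=> // x; rewrite inE => /orP[/eqP ->|/sX //]; apply: mem_set.
  exact: YX.
suff UX : U = X by rewrite -/U UX; apply: FP.
have idX : is_ideal X by have /FP[//|/Qid] := FX.
apply/seteqP; split=> [|x Xx]; last by exists X.
by rewrite Us; apply: smallest_sub => // x /sX /set_mem.
Qed.

(** Maximality in the form used below: each [x] outside [M] gives an equation [1 = r * x + m] with
    [m] in [M]. *)
Definition maximal_ideal (R : comNzRingType) (M : set R) : Prop :=
  [/\ is_ideal M, ~ M 1 & forall x, ~ M x -> adjoin x M 1].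

Lemma exists_maximal_ideal (R : comNzRingType) (I : set R) :
  noetherian R -> is_ideal I -> ~ I 1 ->
  exists2 M, maximal_ideal M & I `<=` M.
Proof.
move=> noethR idI I1.
pose Q := [set J : set R | [/\ is_ideal J, ~ J 1 & I `<=` J]].
have [||M [[idM M1 IM] Mmax]] := @noetherian_max _ Q I noethR.
- by move=> J [].
- by split.
exists M => //; split=> // x Mx; apply: contrapT => M1x; apply: Mx.
apply: (Mmax (adjoin x M)); last exact: mem_adjoin.
  split=> //; first exact: adjoin_ideal.
  by move=> y /IM; apply: sub_adjoin.
exact: sub_adjoin.
Qed.

(** * Radicals and 1-absorbing primary ideals *)

Lemma prime_idealX (R : comNzRingType) (P : set R) (x : R) (n : nat) :
  is_prime_ideal P -> P (x ^+ n) -> P x.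
Proof.
move=> [/proper_idealE[idP P1] Pprime]; elim: n => [|n IH]; first by rewrite expr0.
by rewrite exprS => /mem_set/Pprime/orP[/set_mem|/set_mem/IH].
Qed.

(* [1 - m] divides [1 - m ^+ n]. *)
Lemma ideal_radical1 (R : comNzRingType) (I : set R) (y m : R) :
  is_ideal I -> I y -> radical I m -> 1 = y + m -> I 1.
Proof.
move=> idI Iy [n _ Imn] E; rewrite -[1](subrK (m ^+ n)); apply: idealD => //.
rewrite -opprB subrX1 -mulNr opprB; apply: idealMr => //.
by rewrite E addrK.
Qed.

(** If [c] is outside [M], then [1 = r * c + m] with a power of [m] in [I]. The ideal [(I : a b)]
    contains [r * c] and that power, hence [1], so [a * b] is in [I]. *)
Lemma one_absorbing_of_maximal (R : idomainType) (M I : set R) :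
  maximal_ideal M -> is_ideal I -> ~ I 1 -> M `<=` radical I ->
  one_absorbing_primary I.
Proof.
move=> [idM M1 Mmax] idI I1 MI; split; first exact/proper_idealE.
move=> a b c _ _ _ Iabc.
have [/MI|/Mmax/adjoinP[r [m [/MI[n n0 In] E]]]] := pselect (M c); [by right|left].
rewrite -[a * b]mul1r.
have idJ : is_ideal (colon I [set a * b]) by apply: colon_ideal.
apply: (@ideal_radical1 _ _ (r * c) m idJ) => //.
  by move=> _ ->; rewrite -mulrA; apply: idealM => //; rewrite mulrC.
by exists n => // x _; apply: idealMr.
Qed.

(* For [n > 0] split [(a b)^n] as [a^n * a^n * b^(2n)] inside [(a b)^(2n)]. *)
Lemma radical_prime (R : idomainType) (I : set R) :
  one_absorbing_primary I -> is_prime_ideal (radical I).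
Proof.
move=> [/proper_idealE[idI I1] absI].
have radI1 : ~ radical I 1 by case=> n _; rewrite expr1n.
have radM a x : radical I x -> radical I (a * x).
  by case=> n n0 In; exists n => //; rewrite exprMn; apply: idealM.
have radX x n : (0 < n)%N -> radical I (x ^+ n) -> radical I x.
  by move=> n0 [k k0 Ik]; exists (n * k)%N; rewrite ?muln_gt0 ?n0 // exprM.
have unitXn (x : R) n : x \isn't a GRing.unit -> (0 < n)%N -> x ^+ n \isn't a GRing.unit.
  by move=> xU n0; rewrite unitrX_pos.
split; last first.
  move=> u v /set_mem rIuv; apply/orP.
  have [uU|uU] := boolP (u \is a GRing.unit).
    by right; apply: mem_set; rewrite -[v](mulKr uU); apply: radM.
  have [vU|vU] := boolP (v \is a GRing.unit).
    by left; apply: mem_set; rewrite -[u](mulrK vU) mulrC; apply: radM.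
  case: rIuv => n n0 In.
  have n20 : (0 < n + n)%N by rewrite addn_gt0 n0.
  have := absI (u ^+ n) (u ^+ n) (v ^+ (n + n)).
  case; rewrite ?unitXn //.
  - by rewrite -exprD -exprMn exprD; apply: idealM.
  - by rewrite -exprD => Iu; left; apply: mem_set; exists (n + n)%N.
  - by move=> /radX rIv; right; apply: mem_set; apply: rIv.
apply/proper_idealE; split=> //; apply/is_idealP; split=> //.
  by exists 1%N => //; rewrite expr1; apply: ideal0.
move=> x y [n n0 In] [m m0 Im]; exists (n + m)%N; first by rewrite addn_gt0 n0.
rewrite exprDn; elim/big_ind: _ => [|a b Ia Ib|i _]; [exact: ideal0|exact: idealD|].
rewrite -mulr_natr; apply: idealMr => //.
(* Each binomial term contains [x] to a power at least [n] or [y] to a power at least [m]. *)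
have [lein|ltni] := leqP i m.
  by apply: idealMr => //; rewrite -addnBA // exprD; apply: idealMr.
by apply: idealM => //; rewrite -(subnK (ltnW ltni)) exprD; apply: idealM.
Qed.

(** * Invertibility expressed inside the ring *)

(* Denominators are cleared by [d], so the inverse stays inside [R]: the
   fractional inverse of [A] is [d^-1 * colon (d) A]. *)
Definition inv_ideal (R : idomainType) (A : set R) : Prop :=
  exists2 d, d != 0 & setprod A (colon (principal d) A) d.

Lemma fraction_repr (R : idomainType) (q : {fraction R}) :
  exists n d, d != 0 /\ q * tofrac d = tofrac n.
Proof.
elim/quotW: q => x; exists (frac x).1, (frac x).2; split; first exact: denom_ratioP.
rewrite !piE /FracField.mulf; apply/eqmodP => /=.
rewrite /FracField.equivf !numden_Ratio ?(mulf_neq0, oner_neq0, denom_ratioP) //.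
by rewrite !mulr1 mulrC.
Qed.

Lemma tofrac_inj (R : idomainType) : injective (@tofrac R).
Proof. by move=> x y /eqP; rewrite tofrac_eq => /eqP. Qed.

Lemma invertibleP (R : idomainType) (A : set R) :
  invertible A <-> inv_ideal A.
Proof.
split=> [invA|[d dn0 Ad]]; last first.
  have fdn0 : tofrac d != 0 by rewrite tofrac_eq0.
  apply/seteqP; split.
    apply: setprod_ind => [|_ _ [r _ <-] [t _ <-]|_ q [a Aa <-] iq].
    - by exists 0; rewrite ?tofrac0.
    - by exists (r + t); rewrite ?tofracD.
    - by rewrite mulrC; apply: iq; exists a.
  move=> _ [r _ <-].
  (* Every [y] in [A (d : A)] is divided by [d] term by term; the case [y = d] then yields [r]. *)
  suff: setprod A (colon (principal d) A) `<=`
        [set y | setprod (@tofrac R @` A) (ideal_inv A) (tofrac y / tofrac d * tofrac r)].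
    by move=> /(_ d Ad) /=; rewrite divff ?mul1r.
  apply: setprod_ind => [|x y xA yA|a k Aa kA] /=.
  - by rewrite tofrac0 !mul0r; apply: setprod0.
  - by rewrite tofracD !mulrDl; apply: setprodD.
  - rewrite tofracM -!mulrA; apply: setprodM; first by exists a.
    move=> _ [x Ax <-]; have [t _ E] := kA x Ax; exists (r * t) => //.
    have E' : tofrac k * tofrac x = tofrac d * tofrac t by rewrite -!tofracM -E.
    transitivity (tofrac k * tofrac x / tofrac d * tofrac r); last by ring.
    by rewrite E' [tofrac d * _]mulrC mulfK // mulrC tofracM.
(* Conversely, every finite sum in [A A^-1] is written with one common denominator [d]; the sum [1]
   then has numerator [d] itself. *)
suff: setprod (@tofrac R @` A) (ideal_inv A) `<=`
      [set z | exists d y, [/\ d != 0, z * tofrac d = tofrac y &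
                            setprod A (colon (principal d) A) y]].
  move=> /(_ 1)[|d [y [dn0 E Ay]]].
    by rewrite invA; exists 1; rewrite ?tofrac1.
  by exists d => //; move: E Ay; rewrite mul1r => /tofrac_inj <-.
(* Rescaling brings two sums to the common denominator [d * d']. *)
have scale v d y : setprod A (colon (principal d) A) y ->
    setprod A (colon (principal (v * d)) A) (v * y).
  move: y; apply: setprod_ind => [|x y xA yA|a k Aa kA] /=.
  - by rewrite mulr0; apply: setprod0.
  - by rewrite mulrDr; apply: setprodD.
  - rewrite mulrCA; apply: setprodM => // x /kA[t _ E]; exists t => //.
    by rewrite -mulrA E mulrA.
apply: setprod_ind.
- by exists 1, 0; split; [exact: oner_neq0|rewrite tofrac0 mul0r|apply: setprod0].
- move=> z z' [d [y [dn0 E Ay]]] [d' [y' [d'n0 E' Ay']]].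
  exists (d * d'), (d' * y + d * y'); split; first by rewrite mulf_neq0.
    by rewrite tofracD !tofracM -E -E'; ring.
  by apply: setprodD; [rewrite mulrC|]; apply: scale.
move=> _ q [a Aa <-] iq; have [u [v [vn0 E]]] := fraction_repr q.
exists v, (a * u); split; rewrite // -?mulrA ?E ?tofracM //.
apply: setprodM => // x Ax.
have /iq[t _ F] : [set q * tofrac y | y in A] (q * tofrac x) by exists x.
by exists t => //; apply: tofrac_inj; rewrite !tofracM F -E mulrCA mulrA.
Qed.

(** * Arithmetic of invertible ideals *)

Lemma inv_ideal1 (R : idomainType) (A : set R) : is_ideal A -> A 1 -> inv_ideal A.
Proof.
move=> idA A1; exists 1; first exact: oner_neq0.
by rewrite -[X in setprod _ _ X]mulr1; apply: setprodM => // x _; exists x; rewrite // mul1r.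
Qed.

(** The product of [(d : A)] and [(e : B)] lies in [(d e : A B)], so multiplying out the sums for
    [d] and [e] gives one for [d * e]. *)
Lemma inv_idealM (R : idomainType) (A B : set R) :
  is_ideal A -> is_ideal B -> inv_ideal A -> inv_ideal B -> inv_ideal (setprod A B).
Proof.
move=> idA idB [d dn0 dA] [e en0 eB]; exists (d * e); first by rewrite mulf_neq0.
set K := setprod (setprod A B) _.
have idK : is_ideal K by apply/setprod_ideal/colon_ideal/principal_ideal.
suff: setprod A (colon (principal d) A) `<=` [set y | K (y * e)] by apply.
apply: setprod_ind => /= [|x y Kx Ky|a k Aa Ak].
- by rewrite mul0r; apply: ideal0.
- by rewrite mulrDl; apply: idealD.
suff: setprod B (colon (principal e) B) `<=` [set z | K (a * k * z)] by apply.
apply: setprod_ind => /= [|x y Kx Ky|b l Bb Bl].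
- by rewrite mulr0; apply: ideal0.
- by rewrite mulrDr; apply: idealD.
rewrite mulrACA; apply: setprodM; first exact: setprodM.
suff: setprod A B `<=` colon (principal (d * e)) [set k * l].
  by move=> ABkl z /ABkl/(_ _ erefl); rewrite [z * _]mulrC.
apply: setprod_sub => [|x y Ax By _ ->]; first exact/colon_ideal/principal_ideal.
rewrite [x * y * _]mulrC; have [[t _ E] [s _ F]] := (Ak x Ax, Bl y By).
by exists (t * s) => //; rewrite mulrACA E F mulrACA.
Qed.

(** To contain is to divide. Writing [d] as a sum of terms [a * k], any [x] in [I] is the sum of the
    [a * (k * x / d)], where [k * x / d] lies in [(I : A)]. *)
Lemma inv_ideal_factor (R : idomainType) (A I : set R) :
  is_ideal A -> is_ideal I -> inv_ideal A -> I `<=` A -> I = setprod A (colon I A).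
Proof.
move=> idA idI [d dn0 dA] IA; apply/seteqP; split; last first.
  by apply: setprod_sub => // a k Aa; rewrite mulrC; apply.
move=> x Ix.
suff: setprod A (colon (principal d) A) `<=`
      [set y | exists2 z, setprod A (colon I A) z & x * y = d * z].
  move=> /(_ d dA)[z Az]; rewrite mulrC => /(mulfI dn0) -> //.
apply: setprod_ind => [|y y' [z Az E] [z' Az' E']|a k Aa Ak] /=.
- by exists 0; rewrite ?mulr0 //; apply: setprod0.
- by exists (z + z'); rewrite ?mulrDr ?E ?E' //; apply: setprodD.
have [r _ E] := Ak x (IA x Ix).
exists (a * r); last by rewrite mulrCA -[d * _]mulrCA E; ring.
apply: setprodM => // y Ay; have [t _ F] := Ak y Ay.
(* Here [r] is [k * x / d] and [t] is [k * y / d]. *)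
suff -> : r * y = t * x by apply: idealM.
by apply: (mulfI dn0); rewrite mulrA E mulrA F; ring.
Qed.

(** Multiplying by [(d : A)] puts [d] in [A J (d : A)], hence in [d J]; then [d] cancels. *)
Lemma inv_ideal_cancel (R : idomainType) (A J : set R) :
  is_ideal J -> inv_ideal A -> A `<=` setprod A J -> J 1.
Proof.
move=> idJ [d dn0 dA] AAJ.
pose dJ := [set d * z | z in J].
have iddJ : is_ideal dJ.
  apply/is_idealP; split=> [|_ _ [y Jy <-] [z Jz <-]|a _ [y Jy <-]].
  - by exists 0; rewrite ?mulr0 //; apply: ideal0.
  - by exists (y + z); rewrite ?mulrDr //; apply: idealD.
  - by exists (a * y); rewrite 1?mulrCA //; apply: idealM.
suff [z Jz] : dJ d by rewrite -[RHS]mulr1 => /(mulfI dn0) <-.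
apply: (@setprod_sub _ A (colon (principal d) A)) => // a k /AAJ aJ kA.
suff: colon dJ [set k] a by apply.
apply: (@setprod_sub _ A J) aJ; first exact: colon_ideal.
move=> x y Ax Jy _ ->; have [t _ E] := kA x Ax; exists (t * y); first exact: idealM.
by rewrite mulrA E; ring.
Qed.

(** * Prime and primary ideals when all nonzero ideals are invertible *)

(** For [x] outside [P] and [J = P + (x)], primality gives [(P : J)] inside [P]. So [P = J (P : J)]
    lies in [P J], and cancelling [P] leaves [1] in [J]. *)
Lemma inv_prime_maximal (R : idomainType) (P : set R) :
  (forall I : set R, is_ideal I -> (exists2 x, I x & x != 0) -> inv_ideal I) ->
  is_prime_ideal P -> (exists2 x, P x & x != 0) -> maximal_ideal P.
Proof.
move=> invR [/proper_idealE[idP P1] Pprime] Pn0; split=> // x Px.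
have idJ := @adjoin_ideal _ x P idP; set J := adjoin x P in idJ *.
have PJ : P `<=` J by apply: sub_adjoin.
have invJ : inv_ideal J by apply: invR => //; case: Pn0 => y /PJ; exists y.
apply: (@inv_ideal_cancel _ P) => //; first exact: invR.
rewrite {1}[P](@inv_ideal_factor _ J) //; apply: setprod_sub; first exact: setprod_ideal.
move=> y k Jy kP; rewrite mulrC; apply: setprodM => //.
by have := kP x (@mem_adjoin _ x P idP) => /mem_set/Pprime/orP[]/set_mem.
Qed.

(** The condition on the radical passes from [I] to the larger ideal [(I : P)], as the Noetherian
    induction requires; [n = 0] accounts for [I = R]. *)
Lemma inv_primary_pow (R : idomainType) (P I : set R) :
  noetherian R ->
  (forall I : set R, is_ideal I -> (exists2 x, I x & x != 0) -> inv_ideal I) ->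
  maximal_ideal P -> is_ideal I -> (exists2 x, I x & x != 0) -> P `<=` radical I ->
  exists n, I = ideal_pow P n.
Proof.
move=> noethR invR [idP P1 Pmax] idI In0 PI; apply: contrapT => Inpow.
pose Q := [set I : set R | [/\ is_ideal I, exists2 x, I x & x != 0, P `<=` radical I &
                            ~ exists n, I = ideal_pow P n]].
have [||{idI In0 PI Inpow}{}I [[idI In0 PI Inpow] Imax]] := @noetherian_max _ Q I noethR.
- by move=> J [].
- by split.
have [IP|] := pselect (I `<=` P); last first.
  move=> /existsNP[x /not_implyP[Ix /Pmax/adjoinP[r [m [/PI rm E]]]]].
  have I1 := ideal_radical1 idI (idealM r idI Ix) rm E.
  by apply: Inpow; exists 0%N; apply/seteqP; split=> // y _; apply: ideal1.
have sIJ := @sub_colon _ I P idI.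
have idJ := @colon_ideal _ I P idI.
have Jn0 : exists2 x, colon I P x & x != 0 by case: In0 => x /sIJ; exists x.
have Pn0 : exists2 x, P x & x != 0 by case: In0 => x /IP; exists x.
have PJ : P `<=` radical (colon I P) by move=> x /PI[n n0 /sIJ]; exists n.
have IE := inv_ideal_factor idP idI (invR _ idP Pn0) IP.
have [[n Jn]|Jnpow] := pselect (exists n, colon I P = ideal_pow P n).
  by apply: Inpow; exists n.+1; rewrite ideal_powS -Jn.
(* By maximality of the counterexample, [(I : P)] is contained in [I]. Hence [I = P (I : P)] lies in
   [I P], and cancelling [I] puts [1] in [P]. *)
apply/P1/(inv_ideal_cancel idP (invR _ idI In0)).
rewrite {1}IE; apply: setprod_sub; first exact: setprod_ideal.
move=> a k Pa Jk; rewrite mulrC; apply: setprodM => //.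
by apply: (Imax (colon I P)).
Qed.

(** * Nakayama's lemma *)

(* The generators of [N] are removed one at a time: if [1 + m] multiplies [N]
   into [(g) + T] then, as [N] lies in [M N + K], it multiplies [N], and hence
   [g], even into [M g + T]; so some other element of [1 + M] kills [g] mod [T]. *)
Lemma nakayama (R : comNzRingType) (M N K : set R) :
  noetherian R -> is_ideal M -> is_ideal N -> is_ideal K ->
  (forall x, N x -> exists y k, [/\ setprod M N y, K k & x = y + k]) ->
  exists2 m, M m & forall x, N x -> K ((1 + m) * x).
Proof.
move=> noethR idM idN idK NMK; have [s Ns] := noethR _ idN.
have sN x : x \in s -> N x by move=> xs; rewrite Ns; apply: sub_gen_smallest.
have idKs t : is_ideal (foldr (@adjoin R) K t).
  by elim: t => //= g t; apply: adjoin_ideal.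
have KKs t : K `<=` foldr (@adjoin R) K t.
  by elim: t => //= g t IH x /IH; apply: sub_adjoin.
have [m Mm Nm] : exists2 m, M m & forall x, N x -> foldr (@adjoin R) K s ((1 + m) * x).
  exists 0 => [|x]; first exact: ideal0.
  rewrite addr0 mul1r Ns; apply: smallest_sub => //.
  move=> {}x /=; elim: {Ns sN} s => //= g t IH; rewrite inE => /orP[/eqP ->|/IH].
    exact: mem_adjoin.
  exact: sub_adjoin.
elim: s m Mm Nm sN {Ns} => [|g t IH] m Mm Nm sN; first by exists m.
have idT := idKs t; have KT := KKs t; set T := foldr _ K t in idT KT IH *.
pose L := [set p * g + u | p in M & u in T].
have idL : is_ideal L.
  apply/is_idealP; split=> [|_ _ [p Mp [u Tu <-]] [q Mq [v Tv <-]]|b _ [p Mp [u Tu <-]]].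
  - by exists 0; [|exists 0]; rewrite ?mul0r ?addr0 //; apply: ideal0.
  - by exists (p + q); [|exists (u + v)]; [apply: idealD|apply: idealD|ring].
  - by exists (b * p); [|exists (b * u)]; [apply: idealM|apply: idealM|ring].
have NL x : N x -> L ((1 + m) * x).
  move=> /NMK[y [k [MNy Kk ->]]]; rewrite mulrDr; apply: idealD => //; last first.
    exists 0; first exact: ideal0.
    by exists ((1 + m) * k); [apply: idealM => //; apply: KT|ring].
  suff: colon L [set 1 + m] y by rewrite mulrC; apply.
  apply: (@setprod_sub _ M N) MNy; first exact: colon_ideal.
  move=> p z Mp /Nm /adjoinP[r [u [Tu E]]] _ ->; exists (p * r); first exact: idealMr.
  by exists (p * u); [apply: idealM|transitivity (p * (r * g + u)); [|rewrite -E]; ring].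
have [p Mp [u Tu E]] := NL g (sN g (mem_head _ _)).
(* The new multiplier is [(1 + m) * (1 + m - p)]: the first factor sends [N] into [(g) + T], and the
   second sends [g] to [u] in [T]. *)
apply: (IH (m - p + m * (1 + m - p))).
- by apply: idealD; [|apply: idealB|apply: idealMr].
- move=> x /Nm /adjoinP[r [v [Tv F]]].
  have -> : (1 + (m - p + m * (1 + m - p))) * x = r * u + (1 + m - p) * v.
    have -> : u = (1 + m) * g - p * g by rewrite -E; ring.
    have -> : v = (1 + m) * x - r * g by rewrite F; ring.
    by ring.
  by apply: idealD; [|apply: idealM|apply: idealM].
- by move=> x xt; apply: sN; rewrite inE xt orbT.
Qed.

(** With [K = 0] some [1 + m] kills [I]. In a domain a nonzero [x] in [I] would force [1 = - m],
    which lies in [M]. *)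
Lemma nakayama0 (R : idomainType) (M I : set R) :
  noetherian R -> is_ideal M -> ~ M 1 -> is_ideal I -> I `<=` setprod M I ->
  I `<=` [set 0].
Proof.
move=> noethR idM M1 idI IMI.
have [x Ix|m Mm mI] := nakayama noethR idM idI (@ideal_set1 R).
  by exists x, 0; rewrite addr0; split=> //; apply: IMI.
move=> x /mI /eqP; rewrite mulf_eq0 => /orP[/eqP E|/eqP //].
case: M1; rewrite (_ : 1 = -1 * m); first exact: idealM.
by rewrite -[LHS](addrK m) E; ring.
Qed.

(** * From prime powers to invertibility *)

Lemma maximal_inv (R : idomainType) (M : set R) :
  noetherian R -> maximal_ideal M -> (exists2 x, M x & x != 0) ->
  (forall I : set R, is_proper_ideal I -> I <> [set 0] -> one_absorbing_primary I ->
     exists (P : set R) (n : nat),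
       [/\ is_prime_ideal P, (0 < n)%N & I = ideal_pow P n]) ->
  inv_ideal M.
Proof.
move=> noethR maxM [x0 Mx0 x0n0] primpow; have [idM M1 Mmax] := maxM.
have idMM := @setprod_ideal _ M M idM.
(* Otherwise [M] lies in [M M], and Nakayama makes [M] zero. *)
have [x Mx MMx] : exists2 x, M x & ~ setprod M M x.
  apply: contrapT => noM; move/eqP: x0n0; apply.
  apply: (nakayama0 noethR idM M1 idM) Mx0 => x Mx.
  by apply: contrapT => MMx; apply: noM; exists x.
have idI := @adjoin_ideal _ x _ idMM; set I := adjoin x _ in idI.
have IM : I `<=` M.
  move=> _ /adjoinP[r [y [MMy ->]]]; apply: idealD => //; first exact: idealM.
  by apply: (setprod_sub _ _ MMy) => // a b _; apply: idealM.
have I1 : ~ I 1 by move/IM.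
have MI : M `<=` I.
  have MMI m : M m -> I (m ^+ 2).
    by move=> Mm; apply: sub_adjoin; rewrite expr2; apply: setprodM.
  have [|||P [n [Pprime n0 IE]]] := primpow I.
  - exact/proper_idealE.
  - apply/(ideal_neq0P idI); exists x; first exact: mem_adjoin.
    by apply/eqP => x_0; apply: MMx; rewrite x_0; apply: setprod0.
  - by apply: (one_absorbing_of_maximal maxM) => // m Mm; exists 2%N => //; apply: MMI.
  have [/proper_idealE[idP P1] _] := Pprime.
  have MP : M `<=` P.
    move=> m /MMI; rewrite IE => /(ideal_pow_sub idP n0).
    exact: prime_idealX.
  have PM : P `<=` M.
    move=> y Py; apply: contrapT => /Mmax /adjoinP[r [m [/MP Pm E]]]; apply: P1.
    by rewrite E; apply: idealD => //; apply: idealM.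
  have {MP PM} PE : P = M by apply/seteqP.
  (* Exponent one gives [I = M]; a larger exponent would put [x] in [M M]. *)
  case: n n0 IE => [//|[|n]] _; rewrite PE; first by rewrite (ideal_pow1 idM) => ->.
  rewrite ideal_powS => IE; case: MMx; apply: (setprodS (@ideal_pow_sub _ _ n.+1 idM isT)).
  by rewrite -IE; apply: mem_adjoin.
have [y /MI/adjoinP[r [z [MMz ->]]]|m Mm mM] := nakayama noethR idM idM (principal_ideal x).
  by exists z, (r * x); split=> //; [exists r; rewrite // mulrC|rewrite addrC].
(* The witness for [inv_ideal] is [d = x]: both [1 + m] and [x] lie in [(x : M)], and
   [x = x * (1 + m) + (- m) * x]. *)
exists x.
  by apply/eqP => x_0; apply: MMx; rewrite x_0; apply: setprod0.
have E : x = x * (1 + m) + (- m) * x by ring.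
rewrite [X in setprod _ _ X]E.
apply: setprodD; apply: setprodM => //.
  by rewrite -mulN1r; apply: idealM.
by move=> y _; exists y.
Qed.

Lemma inv_of_maximal_inv (R : idomainType) :
  noetherian R ->
  (forall M : set R, maximal_ideal M -> (exists2 x, M x & x != 0) -> inv_ideal M) ->
  forall I : set R, is_ideal I -> (exists2 x, I x & x != 0) -> inv_ideal I.
Proof.
move=> noethR invM I idI In0; apply: contrapT => ninvI.
pose Q := [set I : set R | [/\ is_ideal I, exists2 x, I x & x != 0 & ~ inv_ideal I]].
have [||{idI In0 ninvI}{}I [[idI In0 ninvI] Imax]] := @noetherian_max _ Q I noethR.
- by move=> J [].
- by split.
have I1 : ~ I 1 by move=> I1; apply/ninvI/inv_ideal1.
have [M maxM IM] := exists_maximal_ideal noethR idI I1.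
have [idM M1 _] := maxM.
have sIJ := @sub_colon _ I M idI; have idJ := @colon_ideal _ I M idI.
have Jn0 : exists2 x, colon I M x & x != 0 by case: In0 => x /sIJ; exists x.
have invMM : inv_ideal M by apply: invM => //; case: In0 => x /IM; exists x.
have IE := inv_ideal_factor idM idI invMM IM.
have [invJ|ninvJ] := pselect (inv_ideal (colon I M)).
  by apply: ninvI; rewrite IE; apply: inv_idealM.
(* A non-invertible [(I : M)] cannot exceed the maximal counterexample [I]; then [I] lies in [M I],
   and Nakayama makes it zero. *)
have JI : colon I M `<=` I by apply: Imax.
case: In0 => x Ix /eqP; apply.
apply: (nakayama0 noethR idM M1 idI) Ix.
by rewrite {1}IE; apply: setprodS.
Qed.

(** * The equivalence *)

(** The right side also covers [I = R], since ideals built by [adjoin] or [colon] may be the whole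
    ring. *)
Lemma dedekindP (R : idomainType) :
  dedekind R <->
  (forall I : set R, is_ideal I -> (exists2 x, I x & x != 0) -> inv_ideal I).
Proof.
split=> [dedR I idI In0|invR I /proper_idealE[idI _] In0]; last first.
  by apply/invertibleP/invR => //; apply/ideal_neq0P.
have [I1|I1] := pselect (I 1); first exact: inv_ideal1.
by apply/invertibleP/dedR; [apply/proper_idealE|apply/ideal_neq0P].
Qed.

Theorem theorem16 (R : idomainType)
    (hnoeth : noetherian R)
    (hnfield : ~ GRing.field_axiom R) :
  dedekind R <->
  (forall I : set R, is_proper_ideal I -> I <> [set 0] ->
     (one_absorbing_primary I <->
      exists (P : set R) (n : nat),
        [/\ is_prime_ideal P, (0 < n)%N & I = ideal_pow P n])).
Proof.
rewrite dedekindP; split=> [invR I|h]; last first.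
  apply: inv_of_maximal_inv => // M maxM Mn0; apply: maximal_inv => // I pI In0.
  by case: (h I pI In0).
rewrite proper_idealE => -[idI I1] /(ideal_neq0P idI) In0; split=> [absI|].
  have radP := radical_prime absI.
  have IradI : I `<=` radical I by move=> x Ix; exists 1%N.
  have maxP : maximal_ideal (radical I).
    by apply: inv_prime_maximal => //; case: In0 => x /IradI; exists x.
  have [[|n] IE] := inv_primary_pow hnoeth invR maxP idI In0 (fun x rx => rx).
    (* Exponent zero would make [I] the whole ring. *)
    by case: I1; rewrite IE.
  by exists (radical I), n.+1.
move=> [P [n [Pprime n0 IE]]]; have [/proper_idealE[idP P1] _] := Pprime.
have IP : I `<=` P by rewrite IE; apply: ideal_pow_sub.
apply: (@one_absorbing_of_maximal _ P) => //.
  by apply: inv_prime_maximal => //; case: In0 => x /IP; exists x.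
by move=> x Px; exists n => //; rewrite IE; apply: mem_ideal_pow.
Qed.
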